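(* For each integer $n\ge 0$, $n\text{-niSDPDA} \subsetneq (n+1)\text{-niSDPDA}$.
   Context: Alphabets are finite nonempty sets; $\varepsilon$ denotes the empty string. A stateless deterministic pushdown automaton is $M=(\Sigma,\Gamma,\delta,\alpha)$, where $\Sigma$ is the input alphabet, $\Gamma$ is the pushdown alphabet, $\alpha\in\Gamma^+$ is the initial pushdown string, and $\delta$ maps $\Gamma\times(\Sigma\cup\{\varepsilon\})$ to finite subsets of $\Gamma^*$, subject to determinism: $|\delta(A,a)|\le 1$ for all $A\in\Gamma$, $a\in\Sigma\cup\{\varepsilon\}$, and if $\delta(A,\varepsilon)\neq\emptyset$ then $\delta(A,a)=\emptyset$ for all $a\in\Sigma$. Configurations are pairs $(\gamma,\sigma)\in\Gamma^*\times\Sigma^*$ (pushdown content with the top as the rightmost symbol, and unread input). The step relation is $(\gamma A,a\sigma)\vdash(\gamma w,\sigma)$ whenever $w\in\delta(A,a)$, with $A\in\Gamma$, $a\in\Sigma\cup\{\varepsilon\}$; $\vdash^*$ is its reflexive and transitive closure. The accepted language (by empty pushdown) is $L(M)=\{w\in\Sigma^*\mid(\alpha,w)\vdash^*(\varepsilon,\varepsilon)\}$. A stateless deterministic pushdown automaton $M=(\Sigma,\Gamma,\delta,\alpha)$ is called $n$-non-input-pushdown-alphabet-limited if the number of non-input pushdown symbols is limited by $n$, that is, if $|\Gamma|-|\Sigma|\le n$. The family $n\text{-niSDPDA}$ consists of all languages accepted by an $n$-non-input-pushdown-alphabet-limited stateless deterministic pushdown automaton.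
   Formalization: A language is taken together with its alphabet, which must be the input alphabet of the accepting automaton; with languages as bare sets of strings, unused letters added to Σ would lower |Γ|−|Σ| at will, all the families would coincide, and the inclusion would not be proper. *)

(* Defs.v *)
From HB Require Import structures.
From Stdlib Require Export Relation_Operators.
From mathcomp Require Export all_boot all_order all_algebra.
From mathcomp Require Export finmap classical_sets.

Set Implicit Arguments.
Unset Strict Implicit.
Unset Printing Implicit Defensive.

Local Open Scope ring_scope.
Local Open Scope fset_scope.
Local Open Scope classical_set_scope.

(* A language carries its alphabet: if it were only a bare set of strings, unused
   input symbols could be added to Sigma at will, and a bound on
   #|Gamma| - #|Sigma| would be no restriction at all. *)
Record language := Language {
  alphabet : finType;
  strings : set (seq alphabet)
}.
Arguments strings : clear implicits.

(* In [delta], [None] is the empty string.  Non-emptiness of Gamma follows from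
   [alpha_neq0]. *)
Record sdpda (Sigma : finType) := SDPDA {
  Gamma : finType;
  delta : Gamma -> option Sigma -> {fset seq Gamma};
  alpha : seq Gamma;
  Sigma_gt0 : (0 < #|Sigma|)%N;
  alpha_neq0 : alpha != [::];
  delta_le1 : forall A a, (#|` delta A a| <= 1)%N;
  delta_eps : forall A, delta A None != fset0 ->
    forall a : Sigma, delta A (Some a) = fset0
}.
Arguments delta {Sigma} s A a.

Section Semantics.
Variables (Sigma : finType) (M : sdpda Sigma).

Definition config := (seq (Gamma M) * seq Sigma)%type.

(* The top of the pushdown is the last element of the list. *)
Inductive step : config -> config -> Prop :=
| Step gamma A (a : option Sigma) sigma w :
    w \in delta M A a ->
    step (rcons gamma A, oapp (cons^~ sigma) sigma a) (gamma ++ w, sigma).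

Definition steps : config -> config -> Prop := clos_refl_trans config step.

Definition accepted : set (seq Sigma) :=
  [set w | steps (alpha M, w) ([::], [::])].

Definition non_input_limited (n : nat) : Prop :=
  (#|Gamma M|%:Z - #|Sigma|%:Z <= n%:Z)%R.

End Semantics.

(* A plain predicate rather than a [set language]: the type of all languages is
   too large for the universe of [set]. *)
Definition niSDPDA (n : nat) (L : language) : Prop :=
  exists M : sdpda (alphabet L),
    non_input_limited M n /\ accepted M = strings L.

(* Main.v *)
(** Let a stateless deterministic pushdown automaton with pushdown alphabet
    Gamma accept a^m and all a^i b with i < m.  In the run on a^i b, let A_i be
    the pushdown symbol that reads b; what lies below A_i is then erased by
    epsilon-moves only.  By determinism A_i, alone on the pushdown, erases
    itself while reading a^(m-i), so A_i = A_j with i < j would make a^(m+j-i)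
    accepted along with its proper prefix a^m.  Hence A_0, ..., A_(m-1) are
    distinct and |Gamma| >= m.  For m = n + 3 and a two-letter input alphabet,
    an automaton with exactly m pushdown symbols separates the families. *)

Require Import Defs.
From Stdlib Require Import Operators_Properties.

Set Implicit Arguments.
Unset Strict Implicit.
Unset Printing Implicit Defensive.

(** * Determinism and decomposition of runs *)

Section Runs.
Variables (Sigma : finType) (M : sdpda Sigma).
Implicit Types (c d : config M) (gam bet w : seq (Gamma M)).
Implicit Types (s t u v : seq Sigma).

Lemma steps_step c c1 c2 : step c c1 -> steps c1 c2 -> steps c c2.
Proof. by move=> c_c1; apply: rt_trans; apply: rt_step. Qed.

Lemma steps_rt1n c d :
  steps c d -> clos_refl_trans_1n (config M) (@step Sigma M) c d.
Proof. exact: clos_rt_rt1n. Qed.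

Lemma step_nil s c : ~ step ([::] : seq (Gamma M), s) c.
Proof.
move=> st; inversion st as [g A a t w w_in E].
by move/(congr1 size): E; rewrite size_rcons.
Qed.

Lemma steps_nil s c : steps ([::] : seq (Gamma M), s) c -> c = ([::], s).
Proof.
by move/steps_rt1n=> st; inversion st as [|y z st1] => //; case: (step_nil st1).
Qed.

Lemma stepP gam A s c : step (rcons gam A, s) c ->
  exists a t w, [/\ s = oapp (cons^~ t) t a, w \in delta M A a
                  & c = (gam ++ w, t)].
Proof.
move=> st; inversion st as [g A' a t w w_in E Ec].
by case/rcons_inj: E => -> <-; exists a, t, w.
Qed.

Lemma delta_inj A a w w' :
  w \in delta M A a -> w' \in delta M A a -> w = w'.
Proof.
move=> w_in w'_in; apply/eqP; apply/negPn/negP => neq_ww'.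
have sub : ([fset w; w'] `<=` delta M A a)%fset.
  by apply/fsubsetP=> x /fset2P [] ->.
by have := leq_trans (fsubset_leq_card sub) (delta_le1 A a);
  rewrite cardfs2 neq_ww'.
Qed.

Lemma delta_eps_excl A x w w' :
  w \in delta M A None -> w' \in delta M A (Some x) -> False.
Proof.
move=> w_in; rewrite delta_eps //.
by apply/fset0Pn; exists w.
Qed.

Lemma step_det c c1 c2 : step c c1 -> step c c2 -> c1 = c2.
Proof.
case: c => gam s; case: (lastP gam) => [/step_nil // | {}gam A].
case/stepP=> [a [t [w [-> w_in ->]]]].
case/stepP=> [a' [t' [w' [E w'_in ->]]]].
case: a a' E w_in w'_in => [x|] [x'|] /=.
- by case=> <- <- w_in w'_in; rewrite (delta_inj w_in w'_in).
- by move=> _ w_in /delta_eps_excl /(_ w_in).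
- by move=> _ /delta_eps_excl ex /ex.
- by move=> <- w_in w'_in; rewrite (delta_inj w_in w'_in).
Qed.

(** Moves are deterministic and an empty pushdown is stuck, so every configuration reachable from
    [c] lies on the run that ends in [([::], s)]. *)
Lemma steps_confl c d s :
  steps c ([::], s) -> steps c d -> steps d ([::], s).
Proof.
move=> c_end /steps_rt1n c_d; elim: c_d c_end => // {c d} c c1 d c_c1 _ IH.
move=> /steps_rt1n c_end; apply: IH.
inversion c_end as [E | c2 z c_c2 c2_end E].
  by rewrite E in c_c1; case: (step_nil c_c1).
by rewrite (step_det c_c1 c_c2); apply: clos_rt1n_rt.
Qed.

(** A move inspects only the top symbol and at most one letter, so it does not depend on deeper
    symbols or later input. *)
Lemma step_frame bet u gam s gam' s' : step (gam, s) (gam', s') ->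
  step (bet ++ gam, s ++ u) (bet ++ gam', s' ++ u).
Proof.
case: (lastP gam) => [/step_nil // | {}gam A].
case/stepP=> [a [t [w [-> w_in [-> ->]]]]].
rewrite -rcons_cat catA.
have -> : oapp (cons^~ t) t a ++ u = oapp (cons^~ (t ++ u)) (t ++ u) a.
  by case: a {w_in}.
exact: Step.
Qed.

Lemma steps_frame bet u gam s gam' s' : steps (gam, s) (gam', s') ->
  steps (bet ++ gam, s ++ u) (bet ++ gam', s' ++ u).
Proof.
move/steps_rt1n; move Ec: (gam, s) => c; move Ed: (gam', s') => d c_d.
elim: c_d gam s Ec Ed => {c d} [c | c [g1 s1] d c_c1 _ IH] gam s Ec Ed.
  by move: Ed; rewrite -Ec; case=> -> ->; apply: rt_refl.
rewrite -Ec in c_c1.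
exact: steps_step (step_frame bet u c_c1) (IH _ _ erefl Ed).
Qed.

Lemma steps_size c d : steps c d -> size d.2 <= size c.2.
Proof.
elim=> {c d} [c d [g A a t w _] | // | c d e _ le_dc _ le_ed].
  by case: a => /=.
exact: leq_trans le_ed le_dc.
Qed.

(** Nothing in [bet] is touched before all that stems from [gam] is erased; [t] is the input unread
    at that moment. *)
Lemma steps_split bet gam s : steps (bet ++ gam, s) ([::], [::]) ->
  exists t, steps (gam, s) ([::], t) /\ steps (bet, t) ([::], [::]).
Proof.
move/steps_rt1n; move Ec: (bet ++ gam, s) => c; move Ed: ([::], [::]) => d.
move=> c_d; elim: c_d gam s Ec Ed =>
  {c d} [c | c c1 d c_c1 c1_d IH] gam s Ec Ed.
  move: Ec; rewrite -Ed; case; case: bet => [|//]; case: gam => [|//] _ ->.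
  by exists [::]; split; apply: rt_refl.
case: (lastP gam) Ec => [|{}gam A] Ec.
  exists s; split; first exact: rt_refl.
  move: Ec; rewrite cats0 => ->.
  by apply: steps_step c_c1 _; apply: clos_rt1n_rt.
rewrite -Ec -rcons_cat in c_c1.
case/stepP: c_c1 => [a [t [w [Es w_in Ec1]]]].
have [|r [gw_r bet_r]] := IH (gam ++ w) t _ Ed; first by rewrite Ec1 catA.
exists r; split=> //; apply: steps_step gw_r.
by rewrite Es; apply: Step.
Qed.

(** The run on [s], framed by [t], empties the pushdown with [t] unread, and no move can follow. *)
Lemma steps_prefix_free gam s t :
  steps (gam, s) ([::], [::]) -> steps (gam, s ++ t) ([::], [::]) -> t = [::].
Proof.
move=> gs /steps_confl gst.
by have /gst/steps_nil[] := steps_frame [::] t gs.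
Qed.

(** [A] is the symbol that reads [x], and [bet] lies below it at that moment. No earlier move
    inspects [x], so these moves also exist on [u] alone. *)
Lemma reading_symbol gam u x : steps (gam, rcons u x) ([::], [::]) ->
  exists A bet, steps (gam, u) (rcons bet A, [::]) /\
                steps (bet, [::]) ([::], [::]).
Proof.
move/steps_rt1n; move Ec: (gam, rcons u x) => c; move Ed: ([::], [::]) => d.
move=> c_d; elim: c_d gam u Ec Ed => {c d} [c | c c1 d c_c1 c1_d IH] gam u.
  by move=> Ec Ed; rewrite -Ed in Ec; case: Ec; case: u.
move=> Ec Ed; rewrite -Ec in c_c1.
case: (lastP gam) c_c1 => [/step_nil // | {Ec}gam A].
case/stepP=> [a [t [w [Es w_in Ec1]]]].
case: a Es w_in => [y|] /= Es w_in; last first.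
  have [|B [bet [st ?]]] := IH (gam ++ w) u _ Ed; first by rewrite Ec1 Es.
  by exists B, bet; split=> //; apply: steps_step st;
    apply: (Step _ (a := None)).
case: u Es => [|z u] [Ey Et].
  (* This move reads [x], the last letter, so [w] and then [gam] are erased without input. *)
  exists A, gam; split; first exact: rt_refl.
  have /steps_split[r [w_r gam_r]] : steps (gam ++ w, [::]) ([::], [::]).
    by rewrite [in X in steps _ X]Ed Et -Ec1; apply: clos_rt1n_rt.
  by rewrite -Ed; have := steps_size w_r; case: r gam_r {w_r}.
have [|B [bet [st ?]]] := IH (gam ++ w) u _ Ed; first by rewrite Ec1 Et.
exists B, bet; split=> //; apply: steps_step st.
by rewrite Ey; apply: (Step _ (a := Some y)).
Qed.

(** * Lower bound on the number of pushdown symbols *)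

Lemma card_Gamma_ge (a b : Sigma) m :
  (forall i, i < m -> accepted M (rcons (nseq i a) b)) ->
  accepted M (nseq m a) -> m <= #|Gamma M|.
Proof.
move=> acc_b acc_m.
have /fin_all_exists[A rdA] (i : 'I_m) := reading_symbol (acc_b i (ltn_ord i)).
suff ltA (i j : 'I_m) : i < j -> A i <> A j.
  rewrite -[m in m <= _]card_ord; apply: (@leq_card _ _ A) => i j eqA.
  by apply/val_inj; case: (ltngtP i j) => // /ltA; rewrite eqA.
move=> lt_ij eqA; have [bi [st_i ep_i]] := rdA i.
have [bj [st_j ep_j]] := rdA j.
set s := nseq (m - i) a.
(* By determinism the accepting run on a^m passes through this configuration after a^i. *)
have steps_bi : steps (bi ++ [:: A i], s) ([::], [::]).
  have Em : nseq m a = nseq i a ++ s by rewrite -nseqD subnKC // ltnW.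
  rewrite /accepted /= Em in acc_m; apply: (steps_confl acc_m).
  by have := steps_frame [::] s st_i; rewrite cats1.
have [t [steps_A steps_t]] := steps_split steps_bi.
(* [bi] is erased on empty input and on [t], so [t] is empty and [A i] alone consumes all of [s]. *)
rewrite (steps_prefix_free (s := [::]) ep_i steps_t) in steps_A.
have acc_long : accepted M (nseq j a ++ s).
  apply: rt_trans ep_j; apply: rt_trans (steps_frame [::] s st_j) _.
  have := steps_frame bj [::] steps_A.
  by rewrite eqA cats1 !cats0.
(* As i < j, the accepted word properly extends a^m. *)
have Elong : nseq j a ++ s = nseq m a ++ nseq (j - i) a.
  by rewrite -!nseqD addnBA 1?ltnW // addnBA 1?ltnW // addnC.
rewrite Elong in acc_long.
have := steps_prefix_free acc_m acc_long.
by move/(congr1 size); rewrite size_nseq => /eqP; rewrite subn_eq0 leqNgt lt_ij.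
Qed.

End Runs.

(** * An automaton attaining the bound *)

Section Counter.
Variable m : nat.

(** [true] plays a and [false] plays b. The single pushdown symbol counts the a's read so far; b
    erases it at any count, and a erases it at count [m]. Thus a^i b for i <= [m] and a^([m]+1) are
    accepted. *)
Definition counter_delta (A : 'I_m.+1) (x : option bool) :
    {fset seq 'I_m.+1} :=
  match x with
  | None => fset0
  | Some c => [fset (if c && (A < m) then [:: inord A.+1] else [::])]%fset
  end.

Lemma card_bool_gt0 : 0 < #|{: bool}|. Proof. by rewrite card_bool. Qed.

Lemma counter_delta_le1 A x : #|` counter_delta A x| <= 1.
Proof. by case: x => [c|]; rewrite /= ?cardfs0 ?cardfs1. Qed.

Lemma counter_delta_eps A : counter_delta A None != fset0 ->
  forall c, counter_delta A (Some c) = fset0.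
Proof. by rewrite eqxx. Qed.

Definition counter : sdpda bool :=
  @SDPDA bool 'I_m.+1 counter_delta [:: ord0] card_bool_gt0 isT
    counter_delta_le1 counter_delta_eps.

Lemma counter_step (A : 'I_m.+1) (c : bool) s :
  @step _ counter ([:: A], c :: s)
    (if c && (A < m) then [:: inord A.+1] else [::], s).
Proof. by apply: (@Step _ counter [::] A (Some c)); apply: fset11. Qed.

Lemma counter_steps i s : i <= m ->
  @steps _ counter ([:: ord0], nseq i true ++ s) ([:: inord i], s).
Proof.
elim: i s => [|i IH] s le_im.
  have -> : inord 0 = ord0 :> 'I_m.+1 by apply/val_inj; rewrite /= inordK.
  exact: rt_refl.
rewrite -[in nseq _ _]addn1 nseqD -catA; apply: rt_trans (IH _ (ltnW le_im)) _.
apply: rt_step; have := counter_step (inord i) true s.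
by rewrite (inordK (leqW le_im)) le_im.
Qed.

Lemma counter_accepts_b i : i < m.+1 ->
  accepted counter (rcons (nseq i true) false).
Proof.
move=> le_im; rewrite -cats1; apply: rt_trans (counter_steps _ le_im) _.
exact: rt_step (counter_step _ false _).
Qed.

Lemma counter_accepts_a : accepted counter (nseq m.+1 true).
Proof.
rewrite -[in nseq _ _]addn1 nseqD.
apply: rt_trans (counter_steps _ (leqnn m)) _; apply: rt_step.
by have := counter_step (inord m) true [::]; rewrite inordK ?ltnn.
Qed.

End Counter.

Theorem theorem3 (n : nat) :
  (forall L : language, niSDPDA n L -> niSDPDA n.+1 L) /\
  (exists L : language, niSDPDA n.+1 L /\ ~ niSDPDA n L).
Proof.
split=> [L [M [limM accM]] | ].
  by exists M; split=> //; apply: (Order.POrderTheory.le_trans limM);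
    rewrite lez_nat leqnSn.
(* [counter n.+2] has n + 3 pushdown symbols, which is n + 1 more than the two input letters. *)
exists (@Language bool (accepted (counter n.+2))); split.
  exists (counter n.+2); split=> //.
  by rewrite /non_input_limited card_bool card_ord.
case=> M [limM accM].
have: n.+3 <= #|Gamma M|.
  apply: (@card_Gamma_ge _ M true false) => [i lt_i|]; rewrite accM.
    exact: counter_accepts_b.
  exact: counter_accepts_a.
move: limM; rewrite /non_input_limited /= card_bool.
by rewrite Num.Theory.lerBlDr -PoszD lez_nat addn2 leqNgt => /negP.
Qed.
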